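(* There exist real functions $\varepsilon_1(n),\varepsilon_2(n)$ with $\varepsilon_1(n)\to 0$ and $\varepsilon_2(n)\to 0$ as $n\to\infty$ such that for all sufficiently large $n$ and every positive integer $b$ the following hold. 1. If $b \geq \frac{n(1+\varepsilon_1(n))}{\ln n}$, then in the $b$-biased orientation game on the edges of $K_n$ Breaker has a strategy guaranteeing that the obtained tournament has a vertex of in-degree $0$ (and in particular that it contains no directed Hamilton cycle). 2. If $b \leq \frac{n(1+\varepsilon_2(n))}{\ln n}$, then in the $b$-biased orientation game on the edges of $K_n$ Maker has a strategy guaranteeing that the obtained tournament contains a directed Hamilton cycle.
   Context: The $b$-biased (i.e. $(1:b)$) orientation game on $K_n$: two players, Maker and Breaker, take turns in orienting (directing) previously undirected edges of the complete graph $K_n$. Maker starts. In each round Maker orients exactly one previously undirected edge, and then Breaker orients at least one and at most $b$ previously undirected edges (if any remain). The players see all moves. The game ends when all edges are oriented, so that a tournament on the $n$ vertices is obtained. A Hamilton cycle in this tournament counts no matter which player oriented each of its edges. The functions $\varepsilon_1,\varepsilon_2$ may be of either sign. *)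

(* Defs.v *)
From mathcomp Require Import all_boot.

Set Implicit Arguments.
Unset Strict Implicit.
Unset Printing Implicit Defensive.

(* A partial orientation of K_n is the set of its arcs; (u, v) is the edge uv
   directed from u to v. A move is the set of arcs added in one turn. *)
Definition orientation (n : nat) := {set 'I_n * 'I_n}.

Definition orients_undirected (n : nat) (A M : orientation n) : bool :=
  [forall u : 'I_n, forall v : 'I_n,
    ((u, v) \in M) ==>
      [&& u != v, (u, v) \notin A, (v, u) \notin A & (v, u) \notin M]].

Definition fully_oriented (n : nat) (A : orientation n) : bool :=
  [forall u : 'I_n, forall v : 'I_n,
    (u != v) ==> ((u, v) \in A) || ((v, u) \in A)].

Definition in_degree (n : nat) (A : orientation n) (v : 'I_n) : nat :=
  #|[set u : 'I_n | (u, v) \in A]|.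

(* In an orientation of K_n, n <> 0, such a cycle has length at least 3, since
   neither loops nor pairs of opposite arcs occur. *)
Definition has_hamilton_cycle (n : nat) (A : orientation n) : Prop :=
  exists c : seq 'I_n,
    ucycle (fun u v => (u, v) \in A) c /\ (forall v : 'I_n, v \in c).

Inductive player := Maker | Breaker.

(* Histories are chronological, oldest move first. *)
Definition history (n : nat) := seq (orientation n).

Definition to_move (n : nat) (h : history n) : player :=
  if odd (size h) then Breaker else Maker.

Definition position (n : nat) (h : history n) : orientation n :=
  \bigcup_(M <- h) M.

Definition max_edges (b : nat) (p : player) : nat :=
  if p is Breaker then b else 1.

(* Fewer edges than the maximum may remain; the upper bound then is harmless.
   For Maker the two bounds say exactly one edge. *)
Definition legal_move (b n : nat) (h : history n) (M : orientation n) : bool :=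
  orients_undirected (position h) M
  && (1 <= #|M| <= max_edges b (to_move h)).

Definition strategy (n : nat) := history n -> orientation n.

(* The histories that can arise when player p follows S and the opponent plays
   arbitrary legal moves. *)
Inductive consistent (b n : nat) (p : player) (S : strategy n) :
    history n -> Prop :=
| consistent_start : consistent b p S [::]
| consistent_own (h : history n) :
    consistent b p S h -> ~~ fully_oriented (position h) ->
    to_move h = p -> consistent b p S (rcons h (S h))
| consistent_opponent (h : history n) (M : orientation n) :
    consistent b p S h -> to_move h <> p -> legal_move b h M ->
    consistent b p S (rcons h M).

(* Besides reaching the goal in every finished game, S must supply a legal move
   whenever p is to move; a finished game always comes about since each legal
   move orients at least one edge. *)
Definition guarantees (b n : nat) (p : player) (S : strategy n)
    (goal : orientation n -> Prop) : Prop :=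
  forall h : history n, consistent b p S h ->
    if fully_oriented (position h) then goal (position h)
    else to_move h = p -> legal_move b h (S h).

Definition can_guarantee (b n : nat) (p : player)
    (goal : orientation n -> Prop) : Prop :=
  exists S : strategy n, guarantees b p S goal.

(* Main.v *)
From HB Require Import structures.
From mathcomp Require Import all_boot all_order all_algebra.
From mathcomp Require Import all_classical all_reals all_analysis.
From mathcomp Require Import ring lra zify.
From mathcomp Require Import fintype finset.
Require Import Defs.
Import Order.TTheory GRing.Theory Num.Theory.
Import numFieldNormedType.Exports.

(** Both parts are proved for a fixed margin [d > 0], that is, for [b] above
    [(1 + d) n / ln n] and below [(1 - d) n / ln n], and for all large [n];
    [diagonal] then lets [d] tend to 0 slowly with [n].

    Breaker aims at a vertex all of whose edges point outwards.  He keeps a set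
    of candidates of in-degree 0, of size [k] at the start, where [ln k] is
    close to [ln n] but [k] is much smaller than [b].  A move of Maker spoils at
    most one candidate, namely the head of the new arc, and with [i] candidates
    left Breaker directs [b / i] edges out of each.  The last candidate
    receives about [b (1 + 1/2 + ... + 1/(k-1))], hence about [b ln k], out-arcs,
    which exceeds [n] ([breaker_wins]).

    Maker only needs a strongly connected tournament, by [camion].

    While little of the board is used, he gives every vertex two in-arcs and two
    out-arcs of his own, unless it has many anyway.  Each of these [2n] demands
    (a box) is endangered by the arcs that use up edges at its vertex in the
    wrong direction.  Maker serves a box of largest danger.  As in the box game
    this keeps the average danger of every set of [k] boxes below a bound [g k]
    that grows by about [b / k] when [k] decreases by 1, so no danger exceeds
    [b ln n] by much, and that is less than [(1 - d/2) n] ([danger_maker]).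
    Hence a linear number of edges is available at the box that is served.
    Maker is free in the choice among them, and a random choice would make all
    small vertex sets expand; a potential function replaces the random choice by
    a deterministic one ([potential_step]).  At the end of this phase every
    vertex is reached from, and reaches, more than [m] vertices, with [m] linear
    in [n] ([expansion_reach]).

    Only [o(n^2)] edges are oriented by then.  As long as some vertex does not
    reach some other, Maker finds a sink component and a source component, both
    of size more than [m], between which an undirected edge remains.  Directing
    it from the sink to the source creates [m^2] new pairs of connected vertices
    ([merge_step]), so this happens a bounded number of times only, after which
    the digraph is strongly connected ([maker_wins]). *)

Set Implicit Arguments.
Unset Strict Implicit.
Unset Printing Implicit Defensive.

(** * Orientations and strategies *)

Definition proper_orientation (n : nat) (P : orientation n) : Prop :=
  forall u v, (u, v) \in P -> u != v /\ (v, u) \notin P.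

Definition undirected (n : nat) (P : orientation n) (u v : 'I_n) : bool :=
  [&& u != v, (u, v) \notin P & (v, u) \notin P].

Lemma undirectedC n (P : orientation n) u v :
  undirected P u v = undirected P v u.
Proof. by rewrite /undirected eq_sym; congr (_ && _); rewrite andbC. Qed.

Lemma orients_undirectedP n (P M : orientation n) :
  reflect (forall u v, (u, v) \in M -> undirected P u v /\ (v, u) \notin M)
          (orients_undirected P M).
Proof.
apply: (iffP idP) => [/forallP H u v uvM|H].
  by have /implyP/(_ uvM)/and4P[uv nP nP' ->] := forallP (H u) v; rewrite /undirected uv nP.
apply/forallP => u; apply/forallP => v; apply/implyP => /H[/and3P[-> -> ->] ->].
by [].
Qed.

Lemma not_fullyP n (P : orientation n) :
  reflect (exists u v, undirected P u v) (~~ fully_oriented P).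
Proof.
apply: (iffP idP) => [|[u [v /and3P[uv nP nP']]]].
  case/forallPn => u /forallPn[v]; rewrite negb_imply negb_or => /andP[uv /andP[nP nP']].
  by exists u, v; rewrite /undirected uv nP.
by apply/forallPn; exists u; apply/forallPn; exists v; rewrite uv (negPf nP) (negPf nP').
Qed.

Lemma fully_oriented_arc n (P : orientation n) : fully_oriented P ->
  forall u v, u != v -> (u, v) \notin P -> (v, u) \in P.
Proof. by move=> /forallP/(_ _)/forallP H u v uv nP; have := H u v; rewrite uv (negPf nP). Qed.

Lemma proper_set0 n : @proper_orientation n set0.
Proof. by move=> u v; rewrite inE. Qed.

Lemma proper_setU n (P M : orientation n) :
  proper_orientation P -> orients_undirected P M -> proper_orientation (P :|: M).
Proof.
move=> pP /orients_undirectedP oM u v; rewrite !inE => /orP[uvP|uvM].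
  have [-> /negPf-> /=] := pP _ _ uvP; split=> //.
  by apply/negP => /oM[/and3P[_ _]]; rewrite uvP.
by have [/and3P[-> _ /negPf->] ->] := oM _ _ uvM.
Qed.

Lemma orients_set1 n (P : orientation n) u v :
  undirected P u v -> orients_undirected P [set (u, v)].
Proof.
move=> uv; apply/orients_undirectedP => x y; rewrite !inE => /eqP[-> ->]; split=> //.
by case/and3P: uv => uv _ _; rewrite xpair_eqE negb_and eq_sym uv.
Qed.

Definition opponent p := if p is Maker then Breaker else Maker.

(** A strategy may depend on the whole history, but one that looks at the
    position only suffices here: [own] holds whenever [p] is to move, [opp]
    whenever the opponent is, and [p] chooses any move that leads from [own] to
    [opp]. *)
Lemma strategy_of_invariants b n p (own opp : orientation n -> Prop) goal :
  (if p is Maker then own set0 else opp set0) ->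
  (forall P, own P -> ~~ fully_oriented P -> exists M,
     [/\ orients_undirected P M, 1 <= #|M| <= max_edges b p & opp (P :|: M)]) ->
  (forall P M, opp P -> orients_undirected P M ->
     1 <= #|M| <= max_edges b (opponent p) -> own (P :|: M)) ->
  (forall P, own P -> fully_oriented P -> goal P) ->
  (forall P, opp P -> fully_oriented P -> goal P) ->
  can_guarantee b p goal.
Proof.
move=> start ownM oppM ownG oppG.
pose good (P M : orientation n) := [/\ orients_undirected P M,
  1 <= #|M| <= max_edges b p & opp (P :|: M)].
pose S (h : history n) := xget (set0 : orientation n) (good (position h)).
have posr h M : position (rcons h M) = position h :|: M.
  by rewrite /position -cats1 big_cat big_seq1.
have tor h M : to_move (rcons h M) = opponent (to_move h).
  by rewrite /to_move size_rcons /=; case: odd.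
have SP h : own (position h) -> ~~ fully_oriented (position h) ->
    good (position h) (S h).
  by move=> oh fh; have [M gM] := ownM _ oh fh; apply: (xgetPex _ (ex_intro _ M gM)).
have inv h : consistent b p S h ->
    (to_move h = p -> own (position h)) /\ (to_move h <> p -> opp (position h)).
  elim=> {h} [|h _ [IH1 _] nf tp|h M _ [_ IH2] tp].
  - by rewrite /position big_nil /to_move /=; by case: p start {ownM oppM good S SP}.
  - rewrite posr tor tp; have [_ _ gS] := SP _ (IH1 tp) nf.
    by split=> //; case: (p).
  - move=> /andP[oM cM]; rewrite posr tor.
    have etp : to_move h = opponent p by case: (to_move h) tp; case: (p).
    split=> [_|]; last by rewrite etp; case: (p).
    by apply: oppM (IH2 tp) oM _; rewrite -etp.
exists S => h /inv[IH1 IH2]; case: ifP => [fh|/negbT fh tp].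
  by have [tp|tp] := pselect (to_move h = p); [apply/ownG/fh/IH1|apply/oppG/fh/IH2].
by have [oS cS _] := SP _ (IH1 tp) fh; rewrite /legal_move oS tp.
Qed.

(** * Hamilton cycles in strongly connected tournaments *)

Lemma connect_closed (T : finType) (e : rel T) (A : pred T) x y :
  (forall u v, A u -> e u v -> A v) -> connect e x y -> A x -> A y.
Proof.
move=> cA /connectP[p + ->]; elim: p x => //= z p IH x /andP[exz pz] Ax.
exact: IH pz (cA _ _ Ax exz).
Qed.

Section Camion.
Variables (T : finType) (e : rel T).
Hypothesis e_asym : forall u v, e u v -> ~~ e v u.
Hypothesis e_total : forall u v, u != v -> e u v || e v u.
Hypothesis e_strong : forall u v, connect e u v.

(** Going round [c] from [x], the predecessor of the first vertex that [w]
    beats is [x] or a vertex that beats [w]; so [w] fits between the two. *)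
Lemma cycle_insert c w x y :
  cycle e c -> uniq c -> w \notin c -> x \in c -> y \in c -> e x w -> e w y ->
  exists c', [/\ cycle e c', uniq c' & size c' = (size c).+1].
Proof.
move=> cc uc wc xc yc exw ewy.
have [i p def_c] := rot_to xc.
have cp : cycle e (x :: p) by rewrite -def_c rot_cycle.
have up : uniq (x :: p) by rewrite -def_c rot_uniq.
have wp : w \notin x :: p by rewrite -def_c mem_rot.
have -> : size c = size (x :: p) by rewrite -def_c size_rot.
have hp : has (e w) p.
  have : y \in x :: p by rewrite -def_c mem_rot.
  rewrite inE => /predU1P[yx|yp]; last by apply/hasP; exists y.
  by move: (e_asym exw); rewrite -yx ewy.
case: (split_find hp) cp up wp => z p1 p2 ewz np1 cp up wp.
have elw : e (last x p1) w.
  case: (lastP p1) np1 wp => [//|q t] np1 wp; rewrite last_rcons.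
  have tw : t != w.
    by apply: contraNneq wp => <-; rewrite inE mem_cat !mem_rcons inE mem_rcons mem_head !orbT.
  have := e_total tw => /orP[//|ewt].
  by case/negP: np1; apply/hasP; exists t => //; rewrite mem_rcons mem_head.
exists (x :: p1 ++ w :: z :: p2); split.
- move: cp; rewrite /= !rcons_cat /= !cat_path /= last_rcons rcons_path.
  by case/andP=> /andP[-> _] ->; rewrite elw ewz.
- have eqp : perm_eq (x :: p1 ++ w :: z :: p2) (w :: x :: rcons p1 z ++ p2).
    by rewrite /= cat_rcons; apply/permEl/(perm_catCA (x :: p1) [:: w]).
  by rewrite (perm_uniq eqp) cons_uniq wp up.
- by rewrite cat_rcons /= !size_cat /= !addnS.
Qed.

(** If no outside vertex can be inserted, each of them is beaten by all of [c]
    or beats all of [c].  By strong connectivity some [a] of the first kind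
    beats some [b] of the second kind, and the path [a, b] fits anywhere. *)
Lemma cycle_extend c : cycle e c -> uniq c -> 0 < size c < #|T| ->
  exists c', [/\ cycle e c', uniq c' & size c < size c'].
Proof.
move=> cc uc /andP[c0 cT].
have [x xc] : exists x, x \in c by case: c c0 {cc uc cT} => // x c; exists x; rewrite mem_head.
have [w wc] : exists w, w \notin c.
  apply/existsP; rewrite -negb_forall; apply: contraL cT => /forallP al.
  by rewrite -leqNgt -(card_uniqP uc); apply/subset_leq_card/subsetP => y _; apply: al.
have [/existsP[w' /andP[w'c /andP[/hasP[y yc eyw] /hasP[z zc ewz]]]]|ni] :=
  boolP [exists w', (w' \notin c) && (has (e^~ w') c && has (e w') c)].
  by have [c' [? ? s]] := cycle_insert cc uc w'c yc zc eyw ewz; exists c'; rewrite s.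
have dicho v : v \notin c -> has (e^~ v) c -> {in c, forall y, e y v}.
  move=> vc hv y yc; have yv : y != v by apply: contraNneq vc => <-.
  have /orP[//|evy] := e_total yv; case/negP: ni; apply/existsP; exists v.
  by rewrite vc hv; apply/hasP; exists y.
(* By [dicho], [A] consists of the vertices that all of [c] beats. *)
pose A := [pred v | (v \notin c) && has (e^~ v) c].
have [a Aa] : exists a, A a.
  apply/existsP; apply: contraT; rewrite negb_exists => /forallP nA.
  have clc u v : mem c u -> e u v -> mem c v.
    move=> uc' euv; apply: contraT => vc.
    by have /negP[] := nA v; rewrite /= vc; apply/hasP; exists u.
  by have := connect_closed clc (e_strong x w) xc; rewrite /= (negPf wc).
have [/existsP[a' /existsP[b' /and3P[Aa' eab nAb]]]|ncl] :=
  boolP [exists a', exists b', [&& A a', e a' b' & ~~ A b']]; last first.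
  have clA u v : A u -> e u v -> A v.
    move=> Au euv; apply: contraT => nAv.
    by case/negP: ncl; apply/existsP; exists u; apply/existsP; exists v; rewrite Au euv.
  by have := connect_closed clA (e_strong a x) Aa; rewrite /= xc.
have [a'c ha] := andP Aa'; have da := dicho _ a'c ha.
have bc : b' \notin c by apply/negP => /da/e_asym; rewrite eab.
have db : {in c, forall y, e b' y}.
  move=> y yc; have yb : y != b' by apply: contraNneq bc => <-.
  have /orP[eyb|//] := e_total yb.
  by case/negP: nAb; rewrite /= bc; apply/hasP; exists y.
exists [:: a', b' & c]; split=> /=; last by rewrite leqW.
- move: c0 cc da db; case: (c) => // y q _ + da db; rewrite /= !rcons_path eab db ?mem_head //=.
  by case/andP=> -> _; rewrite da // mem_last.
- rewrite inE negb_or a'c bc uc !andbT.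
  by apply: contraTneq eab => ->; apply/negP => ee; case/negP: (e_asym ee).
Qed.

(** Camion's theorem.  An arc and a path back from its head close a first
    cycle, and a longest cycle is Hamiltonian by [cycle_extend]. *)
Lemma camion : 1 < #|T| -> exists c, [/\ cycle e c, uniq c & forall v, v \in c].
Proof.
move=> T1.
have [c0 [cc0 uc0 sc0]] : exists c, [/\ cycle e c, uniq c & 0 < size c].
  have [x [y xy]] : exists x y : T, x != y.
    by have /card_gt1P[x [y [_ _ xy]]] := T1; exists x, y.
  case/connectP: (e_strong x y) => [[|z p] /=]; first by move=> _ yx; rewrite yx eqxx in xy.
  move=> /andP[exz _] _; case/connectP: (e_strong z x) => q pq xq.
  case: (shortenP pq) xq => q' pq' uq' _ xq'.
  by exists (z :: q'); split=> //; rewrite /= rcons_path pq' -xq'.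
have [k] : exists k, k = #|T| - size c0 by eexists.
elim/ltn_ind: k c0 cc0 uc0 sc0 => k IH c cc uc sc def_k.
have [cT|Tc] := ltnP (size c) #|T|.
  have [|c' [cc' uc' sc']] := @cycle_extend c cc uc _; first by rewrite sc.
  by apply: (IH (#|T| - size c')) cc' uc' _ erefl; lia.
exists c; split=> // v.
suff /eqP/setP/(_ v) : [set x in c] == [set: T] by rewrite !inE.
by rewrite eqEcard subsetT cardsT cardsE (card_uniqP uc).
Qed.

End Camion.

(** * Breaker's race for a source *)

Definition dominates n (P : orientation n) v := forall u, u != v -> (v, u) \in P.

Definition unreached n (P : orientation n) (A : {set 'I_n}) :=
  forall u v, v \in A -> (u, v) \notin P.

Definition free_out n (P : orientation n) (A : {set 'I_n}) v :=
  [set u | (u \notin A) && undirected P v u].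

(** [A] is the set of candidates for a vertex of in-degree 0.  Each of them has
    received [b %/ i] out-arcs in the round that left [i] candidates, for every
    [i] with [s <= i < k]; with [s = #|A|] when Maker is to move and
    [s = #|A|.+1] when Breaker is, the inequality bounds the edges that it still
    needs outside [A]. *)
Definition race n b k (P : orientation n) s (A : {set 'I_n}) :=
  [/\ 0 < #|A|, unreached P A & forall v, v \in A ->
      \sum_(s <= i < k) b %/ i + #|free_out P A v| + #|A| <= n].

Lemma subset_of_card (T : finType) (A : {set T}) q : q <= #|A| ->
  exists2 B : {set T}, B \subset A & #|B| = q.
Proof.
move=> qA; exists [set x in take q (enum A)].
  by apply/subsetP => x; rewrite inE => /mem_take; rewrite mem_enum.
rewrite cardsE (card_uniqP _) ?take_uniq ?enum_uniq // size_take -cardE.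
by case: ltngtP qA.
Qed.

Lemma dominates_no_cycle n (P : orientation n) v :
  in_degree P v = 0 -> ~ has_hamilton_cycle P.
Proof.
move=> /eqP; rewrite cards_eq0 => /eqP iv [c [/andP[cc _] al]].
by have /setP/(_ (prev c v)) := iv; rewrite !inE (prev_cycle cc (al v)).
Qed.

(** Breaker's winning move, once a candidate has at most [b] edges left. *)
Lemma race_finish n (P : orientation n) A v : unreached P A -> v \in A ->
  let W := [set u | undirected P v u] in
  orients_undirected P (setX [set v] W) /\ dominates (P :|: setX [set v] W) v.
Proof.
move=> unA vA W; split.
  apply/orients_undirectedP => x y; rewrite !inE /= => /andP[/eqP-> vy].
  by split=> //; case/and3P: vy => vy _ _; rewrite eq_sym (negPf vy).
move=> u uv; rewrite !inE eqxx /= /undirected eq_sym uv /= (unA u v vA) andbT.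
by case: (_ \in P).
Qed.

Section Breaker.
Variables (n b k : nat).
Hypothesis k_gt0 : 0 < k.
Hypothesis kn : k <= n.
Hypothesis kb : 2 * k <= b.
Hypothesis win : n <= \sum_(1 <= i < k) b %/ i.

(** The head of the new arc ceases to be a candidate.  If it was not one,
    some candidate is given up, so that exactly one leaves in each round.  The
    edge from the remaining candidates to the one that leaves is new outside
    [A], which the term [#|A|] of the bound compensates.  By [win] the race is
    decided before the last candidate could leave. *)
Lemma race_maker_move (P : orientation n) (A : {set 'I_n}) (x y : 'I_n) : race b k P #|A| A ->
  exists A' : {set 'I_n}, race b k (P :|: [set (x, y)]) #|A'|.+1 A' /\ #|A'| < #|A|.
Proof.
move=> [A0 unA bA].
have A1 : 1 < #|A|.
  rewrite ltn_neqAle A0 andbT; apply/eqP => A1; have /card_gt0P[v vA] := A0.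
  by have := bA v vA; rewrite -A1; lia.
(* [z] is the candidate that leaves. *)
have [z [zA zy]] : exists z, z \in A /\ (y \in A -> z = y).
  have [yA|yA] := boolP (y \in A); first by exists y.
  by have /card_gt0P[v vA] := A0; exists v.
have cA : #|A| = #|A :\ z|.+1 by rewrite (cardsD1 z A) zA.
exists (A :\ z); split; last by rewrite -cA.
split; first by lia.
  move=> u v; rewrite !inE => /andP[vz vA]; rewrite negb_or unA //=.
  apply/eqP => -[_ vy]; move: zy vz; rewrite -vy => /(_ vA) ->; by rewrite eqxx.
move=> v; rewrite !inE => /andP[vz vA]; have := bA v vA.
have : free_out (P :|: [set (x, y)]) (A :\ z) v \subset z |: free_out P A v.
  apply/subsetP => u; rewrite !inE /undirected negb_and negbK !inE !negb_or.
  by case/and3P=> /orP[->//|->] -> /andP[/andP[-> _] /andP[-> _]]; rewrite orbT.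
move=> /subset_leq_card; have := cardsU1 z (free_out P A v); have := leq_b1 (z \notin free_out P A v).
rewrite -cA; move: (#|_ |: _|) (#|free_out (_ :|: _) _ _|) (nat_of_bool _) => *; lia.
Qed.

(** A candidate with more than [b] edges left has at least [b %/ #|A|] of them
    outside [A]: at most [#|A| - 1] are inside, and [2 * #|A| <= b] gives
    [b %/ #|A| <= b %/ 2] as soon as there are two candidates. *)
Lemma race_breaker_move (P : orientation n) (A : {set 'I_n}) : #|A| < k -> race b k P #|A|.+1 A ->
  (forall v, v \in A -> b < #|[set u | undirected P v u]|) ->
  exists M : orientation n,
    [/\ orients_undirected P M, 1 <= #|M| <= b & race b k (P :|: M) #|A| A].
Proof.
move=> Ak [A0 unA bA] bW; set q := b %/ #|A|.
have qA : #|A| * q <= b by rewrite mulnC leq_divM.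
have q0 : 0 < q by rewrite divn_gt0 //; lia.
have Bex v : exists B : {set 'I_n}, v \in A -> B \subset free_out P A v /\ #|B| = q.
  have [vA|_] := boolP (v \in A); last by exists set0.
  have /subset_of_card[B BF Bq] : q <= #|free_out P A v|; last by exists B => _.
  have : [set u | undirected P v u] \subset free_out P A v :|: A :\ v.
    apply/subsetP => u; rewrite !inE => vu; rewrite vu andbT.
    by case/and3P: vu => vu _ _; rewrite eq_sym vu; case: (_ \in A).
  move=> /subset_leq_card; have := bW v vA.
  have := (leq_card_setU (free_out P A v) (A :\ v)).1; have := cardsD1 v A; rewrite vA add1n.
  move: (#|_ :|: _|) (#|free_out P A v|) (#|A :\ v|) => wU wF wA.
  have [i1|i2] := leqP #|A| 1.
    have qb : q <= b by apply: leq_div.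
    by move=> *; lia.
  have : 2 * q <= #|A| * q by rewrite leq_mul2r i2 orbT.
  by move=> *; lia.
have [B hB] := choice Bex.
have BS v u : v \in A -> u \in B v -> u \notin A /\ undirected P v u.
  by move=> vA uB; have [/subsetP/(_ u uB)] := hB v vA; rewrite inE => /andP.
pose M : orientation n := [set a | (a.1 \in A) && (a.2 \in B a.1)].
have cM : #|M| = #|A| * q.
  rewrite -sum1dep_card -(pair_big_dep (mem A) (fun v u => u \in B v) (fun _ _ => 1)) /=.
  rewrite -sum_nat_const; apply: eq_bigr => v vA.
  by rewrite sum1_card; case: (hB v vA).
exists M; split.
- apply/orients_undirectedP => u v; rewrite !inE /= => /andP[uA vB].
  by have [/negPf-> ->] := BS _ _ uA vB.
- by rewrite cM qA muln_gt0 A0 q0.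
- split=> // [u v vA|v vA].
    rewrite !inE /= (negPf (unA _ _ vA)) /=; apply/andP => -[uA vB].
    by have [/negP] := BS _ _ uA vB.
  have := bA v vA; rewrite (big_ltn Ak) -/q.
  have : free_out (P :|: M) A v \subset free_out P A v :\: B v.
    apply/subsetP => u; rewrite !inE /undirected !inE vA /= !negb_or.
    by case/and3P=> -> -> /andP[/andP[-> ->] /andP[-> _]].
  move=> /subset_leq_card; have [BF <-] := hB v vA.
  have := subset_leq_card BF; rewrite cardsD (setIidPr BF).
  lia.
Qed.

(** Either some vertex is already a source for good, or the race goes on. *)
Lemma breaker_wins : can_guarantee b Breaker (fun T : orientation n =>
  (exists v : 'I_n, in_degree T v = 0%N) /\ ~ has_hamilton_cycle T).
Proof.
pose own P := proper_orientation P /\ ((exists v, dominates P v) \/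
  exists2 A : {set 'I_n}, #|A| < k & race b k P #|A|.+1 A).
pose opp P := proper_orientation P /\ ((exists v, dominates P v) \/
  exists2 A : {set 'I_n}, #|A| <= k & race b k P #|A| A).
have domU P M v : dominates P v -> dominates (P :|: M) v.
  by move=> dP u uv; rewrite inE dP.
have goal_of P v : proper_orientation P -> dominates P v ->
    (exists v : 'I_n, in_degree P v = 0%N) /\ ~ has_hamilton_cycle P.
  move=> pP dP; have iv : in_degree P v = 0.
    apply/eqP; rewrite cards_eq0; apply/eqP/setP => u; rewrite !inE.
    by apply/negP => uvP; have [/dP vu] := pP _ _ uvP; rewrite vu.
  by split; [exists v|apply: dominates_no_cycle iv].
have full_dom P A v : unreached P A -> v \in A -> fully_oriented P -> dominates P v.
  by move=> unA vA fP u uv; apply: (fully_oriented_arc fP uv) (unA _ _ vA).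
apply: (@strategy_of_invariants b n Breaker own opp).
- split; first exact: proper_set0.
  right; have [|A _ cA] := @subset_of_card _ [set: 'I_n] k; first by rewrite cardsT card_ord.
  exists A; first by rewrite cA.
  rewrite cA; split; [by rewrite cA|by move=> u v _; rewrite inE|move=> v vA].
  rewrite big_geq // add0n cA -[X in _ <= X](card_ord n) -(cardsC A) cA addnC leq_add2l.
  by apply: subset_leq_card; apply/subsetP => u; rewrite !inE => /andP[].
- move=> P [pP st] nf.
  suff [M [oM cM st']] : exists M : orientation n, [/\ orients_undirected P M, 1 <= #|M| <= b &
      ((exists v, dominates (P :|: M) v) \/ exists2 A : {set 'I_n}, #|A| <= k & race b k (P :|: M) #|A| A)].
    by exists M; split=> //; split=> //; apply: proper_setU.
  have step v : dominates P v -> exists M : orientation n, [/\ orients_undirected P M, 1 <= #|M| <= b &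
      ((exists v, dominates (P :|: M) v) \/ exists2 A : {set 'I_n}, #|A| <= k & race b k (P :|: M) #|A| A)].
    move=> dv; have /not_fullyP[x [y xy]] := nf; exists [set (x, y)].
    rewrite cards1; split; [exact: orients_set1|by lia|].
    by left; exists v; apply: domU.
  case: st => [[v dv]|[A Ak rA]]; first exact: step dv.
  have [/existsP[v /andP[vA Wb]]|] := boolP [exists v, (v \in A) && (#|[set u | undirected P v u]| <= b)].
    have [_ unA _] := rA; have [oM dM] := race_finish unA vA.
    have cM : #|setX [set v] [set u | undirected P v u]| = #|[set u | undirected P v u]|.
      by rewrite cardsX cards1 mul1n.
    have [W0|W0] := posnP #|[set u | undirected P v u]|.
      apply: (step v); move: cM dM; rewrite W0 => /eqP; rewrite cards_eq0 => /eqP->.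
      by rewrite setU0.
    by exists (setX [set v] [set u | undirected P v u]); rewrite cM W0; split=> //; left; exists v.
  move=> /existsPn W; have [v vA|M [oM cM rM]] := race_breaker_move Ak rA.
    by have := W v; rewrite vA ltnNge.
  by exists M; split=> //; right; exists A => //; apply: ltnW.
- move=> P M [pP st] oM /=; rewrite -eqn_leq eq_sym => /cards1P[[x y] eM].
  split; first exact: proper_setU.
  case: st => [[v dv]|[A Ak rA]]; [by left; exists v; apply: domU|right].
  have [A' [rA' A'A]] := race_maker_move x y rA; exists A'; last by rewrite eM.
  exact: leq_trans A'A Ak.
- move=> P [pP [[v dv]|[A _ [/card_gt0P[v vA] unA _]]]] fP; first exact: goal_of dv.
  by apply: (goal_of P v) => //; apply: full_dom vA fP.
- move=> P [pP [[v dv]|[A _ [/card_gt0P[v vA] unA _]]]] fP; first exact: goal_of dv.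
  by apply: (goal_of P v) => //; apply: full_dom vA fP.
Qed.
End Breaker.

(** * Boxes and their dangers *)

(** [(v, true)] stands for the demand of [v] for in-arcs and [(v, false)] for
    its demand for out-arcs. *)
Definition box (n : nat) := ('I_n * bool)%type.

(** The arc between [u] and the vertex of [x] in the direction that [x]
    demands; the opposite arc [hurts] the box. *)
Definition feed n (x : box n) (u : 'I_n) : 'I_n * 'I_n :=
  if x.2 then (u, x.1) else (x.1, u).

Definition end_of n (a : 'I_n * 'I_n) (d : bool) : 'I_n := if d then a.1 else a.2.

Definition hurts n (a : 'I_n * 'I_n) (x : box n) : bool := end_of a x.2 == x.1.

Definition load n (P : orientation n) (x : box n) := #|[set a in P | hurts a x]|.

Definition gain n (P : orientation n) (x : box n) := #|[set u | feed x u \in P]|.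

Definition cover n (P : orientation n) (I : {set box n}) :=
  #|[set a in P | [exists x in I, hurts a x]]|.

(** [F] records the arcs by which Maker has served boxes on purpose, as pairs of
    a box and the other end of the arc.  An arc feeds two boxes, so the set of
    arcs alone would not tell which of them it was meant for. *)
Definition served n (F : {set box n * 'I_n}) (x : box n) := #|[set u | (x, u) \in F]|.

Section Cover.
Variable n : nat.
Implicit Types (P Q : orientation n) (x y : box n) (I : {set box n}).
Implicit Types (F : {set box n * 'I_n}) (u : 'I_n).

Lemma cover_le P I : cover P I <= #|P|.
Proof. by apply: subset_leq_card; apply/subsetP => a; rewrite inE => /andP[]. Qed.

Lemma coverU P Q I : cover (P :|: Q) I <= cover P I + #|Q|.
Proof.
apply: leq_trans (leq_card_setU _ _).1; apply: subset_leq_card; apply/subsetP => a.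
by rewrite !inE => /andP[/orP[->|->] ->]; rewrite ?orbT.
Qed.

Lemma cover1 P x : cover P [set x] = load P x.
Proof.
apply: eq_card => a; rewrite !inE; congr andb.
by apply/exists_inP/idP => [[y /set1P->]|ax] //; exists x; rewrite ?set11.
Qed.

(** The bound on the overlap holds because an arc that hurts [x] and a box of
    [I] is determined by the latter: the two boxes are those of its two ends. *)
Lemma cover_add P I x : x \notin I -> cover P I + load P x <= cover P (x |: I) + #|I|.
Proof.
move=> xI; set A := [set a in P | [exists x in I, hurts a x]].
set B := [set a in P | hurts a x].
have -> : cover P (x |: I) = #|A :|: B|.
  apply: eq_card => a; rewrite !inE -andb_orr; congr andb.
  apply/exists_inP/orP => [[y /setU1P[->|yI] ay]|[/exists_inP[y yI ay]|ax]].
  - by right.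
  - by left; apply/exists_inP; exists y.
  - by exists y; rewrite // setU1r.
  - by exists x; rewrite // setU11.
rewrite -[_ + load P x](cardsUI A B) leq_add2l.
(* An arc at [x] that hurts a second box hurts the one of its other end. *)
pose other (a : 'I_n * 'I_n) : box n := (end_of a (~~ x.2), ~~ x.2).
have inj : {in A :&: B &, injective other}.
  move=> [a1 a2] [c1 c2]; rewrite !inE /hurts /end_of /other /=.
  by case: (x.2) => /=; do 2![case/andP=> _ /andP[_ /eqP->]]; case=> ->.
rewrite -(card_in_imset inj); apply: subset_leq_card; apply/subsetP => _ /imsetP[a + ->].
rewrite !inE => /andP[/andP[_ /exists_inP[[w d] yI ay]] /andP[_ ax]].
have dx : d = ~~ x.2.
  apply: contraNeq xI => dx; have {}dx : d = x.2 by move: dx; case: (d); case: (x.2).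
  by move: ay yI; rewrite /hurts /= dx (eqP ax) => /eqP<-; rewrite -surjective_pairing.
by move: ay yI; rewrite /hurts /other /= -dx => /eqP<-.
Qed.

Lemma cover_sum P I : cover P I <= \sum_(x in I) load P x.
Proof.
have -> : \sum_(x in I) load P x = \sum_(a in P) \sum_(x in I) hurts a x.
  rewrite exchange_big /=; apply: eq_bigr => x _.
  by rewrite /load -sum1dep_card big_mkcondr.
rewrite /cover -sum1dep_card big_mkcondr /=; apply: leq_sum => a _.
case: ifP => // /exists_inP[x xI ax].
by rewrite (bigD1 x xI) /= ax.
Qed.

Lemma degree_split P x :
  n <= #|[set u | undirected P x.1 u]| + load P x + gain P x + 1.
Proof.
have ld : #|[set u | feed (x.1, ~~ x.2) u \in P]| <= load P x.
  have inj : injective (feed (x.1, ~~ x.2)).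
    by rewrite /feed /=; case: (x.2) => /= u v [].
  rewrite -(card_imset _ inj); apply: subset_leq_card; apply/subsetP => _ /imsetP[u + ->].
  by rewrite !inE => ->; rewrite /hurts /end_of /feed /=; case: (x.2) => /=.
have : [set: 'I_n] \subset [set u | undirected P x.1 u] :|:
   [set u | feed (x.1, ~~ x.2) u \in P] :|: [set u | feed x u \in P] :|: [set x.1].
  apply/subsetP => u _; rewrite !inE /undirected /feed /= (eq_sym u).
  by case: (x.2) => /=; case: (x.1 == u); case: ((x.1, u) \in P); case: ((u, x.1) \in P).
move=> /subset_leq_card; rewrite cardsT card_ord => /leq_trans; apply.
apply: leq_trans (leq_card_setU _ _).1 _; rewrite cards1 leq_add2r.
apply: leq_trans (leq_card_setU _ _).1 _; rewrite leq_add2r.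
by apply: leq_trans (leq_card_setU _ _).1 _; rewrite leq_add2l.
Qed.

Lemma servedU F x u y : (x, u) \notin F ->
  served ((x, u) |: F) y = served F y + (y == x).
Proof.
move=> nF; rewrite /served; have [->|yx] := eqVneq y x; last first.
  rewrite addn0; apply: eq_card => w.
  by rewrite !inE xpair_eqE (negPf yx).
rewrite addn1 -[RHS]add1n -[1]/(nat_of_bool true).
have <- : u \notin [set w | (x, w) \in F] by rewrite inE.
rewrite -cardsU1; apply: eq_card => w.
by rewrite !inE xpair_eqE eqxx.
Qed.

Lemma card_served F : #|F| = \sum_x served F x.
Proof.
rewrite -sum1_card (eq_bigl (fun p => (p.1, p.2) \in F)) => [|[] //].
rewrite -(pair_big_dep predT (fun x u => (x, u) \in F) (fun _ _ => 1)) /=.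
by apply: eq_bigr => x _; rewrite sum1dep_card.
Qed.

Lemma card_served_le F : (forall x, served F x <= 2) -> #|F| <= 4 * n.
Proof.
move=> sF; rewrite card_served; apply: leq_trans (leq_sum _ (fun x _ => sF x)) _.
by rewrite sum_nat_const card_prod card_ord card_bool; lia.
Qed.

End Cover.

(** A box that has been fed by [m] arcs, by whichever player, needs no further
    service, since [m] neighbours already are enough for [all_reach].  This case
    has to be set apart: its arcs use up edges without hurting the box, so that
    a small [load] would not leave many undirected edges. *)
Definition alive n m (P : orientation n) F x := (served F x < 2) && (gain P x < m).

(** The invariant of the box game.  An arc may hurt two boxes of [I] but counts
    once in [cover]; summing the loads instead would cost a factor of 2 in the
    bias.  Each service is credited with [b.+1], the number of arcs in a round.
    [a] is the slack: 0 before Breaker's move and [b] after it. *)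
Definition danger_bounded (R : realFieldType) n b m (g : nat -> R) (P : orientation n) F a :=
  forall I : {set box n}, 0 < #|I| -> (forall x, x \in I -> alive m P F x) ->
  ((cover P I)%:R <= #|I|%:R * g #|I| + a%:R + (b.+1 * \sum_(x in I) served F x)%:R)%R.

Section Danger.
Variables (R : realFieldType) (n b m k0 : nat) (g : nat -> R).
Hypothesis g_high : forall k, k0 <= k -> ((4 * n * b.+1)%:R <= k%:R * g k)%R.
Hypothesis g_low : forall k, 0 < k < k0 -> (g k.+1 + (b + 2)%:R / k.+1%:R + 1 <= g k)%R.
Implicit Types (P Q : orientation n) (x y : box n) (I : {set box n}).
Implicit Types (F : {set box n * 'I_n}) (u : 'I_n).

Local Notation danger_bounded := (danger_bounded b m g).

Lemma aliveU P Q F x u y : (x, u) \notin F ->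
  alive m (P :|: Q) ((x, u) |: F) y -> alive m P F y.
Proof.
move=> nF /andP[]; rewrite servedU // => sy gy; apply/andP; split; first by lia.
apply: leq_ltn_trans gy; apply: subset_leq_card; apply/subsetP => w.
by rewrite !inE => ->.
Qed.

Lemma danger_breaker P Q F : #|Q| <= b ->
  danger_bounded P F 0 -> danger_bounded (P :|: Q) F b.
Proof.
move=> Qb dP I I0 aI; have {aI} aI x : x \in I -> alive m P F x.
  move=> /aI /andP[sx gx]; rewrite /alive sx /=; apply: leq_ltn_trans gx.
  by apply: subset_leq_card; apply/subsetP => w; rewrite !inE => ->.
have := dP I I0 aI; have : ((cover (P :|: Q) I)%:R <= (cover P I)%:R + b%:R :> R)%R.
  by rewrite -natrD ler_nat (leq_trans (coverU _ _ _)) // leq_add2l.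
lra.
Qed.

Definition danger P F x : R := ((load P x)%:R - (b.+1 * served F x)%:R)%R.

(** Maker serves a box [x] of largest danger.  A set [I] that contains [x] gains
    the credit of a whole round.  If [x] is not in [I], then the danger of [x]
    is at least the average over [I], so the bound for [x |: I], on [k + 1]
    boxes, passes to [I] at the price of [(b + 2) / (k + 1)] per box for the
    arcs of the round, and of at most 1 for the at most [k] arcs that hurt both
    [x] and [I].  The latter loss is affordable for [k < k0] only; for larger
    sets the bound already follows from the total number of arcs. *)
Lemma danger_maker P F x u a :
  danger_bounded P F b -> alive m P F x -> (x, u) \notin F ->
  (forall y, alive m P F y -> (danger P F y <= danger P F x)%R) ->
  #|P :|: [set a]| <= 4 * n * b.+1 ->
  danger_bounded (P :|: [set a]) ((x, u) |: F) 0.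
Proof.
move=> dP ax nF mx cP I I0 aI'.
have aI y : y \in I -> alive m P F y by move=> /aI'; apply: aliveU.
have sumU : \sum_(y in I) served ((x, u) |: F) y = \sum_(y in I) served F y + (x \in I).
  rewrite (eq_bigr (fun y => served F y + (y == x))); last by move=> y _; exact: servedU.
  rewrite big_split /=; congr addn; have [xI|xI] := boolP (x \in I).
    by rewrite (bigD1 x) //= eqxx big1 // => y /andP[_ /negPf->].
  by rewrite big1 // => y yI; case: eqP xI => // <-; rewrite yI.
have cI : ((cover (P :|: [set a]) I)%:R <= (cover P I)%:R + 1 :> R)%R.
  by rewrite -(natrD _ _ 1) ler_nat (leq_trans (coverU _ _ _)) // cards1.
rewrite sumU addr0; have [k0I|Ik0] := leqP k0 #|I|.
  apply: le_trans (_ : (4 * n * b.+1)%:R <= _)%R; first by rewrite ler_nat (leq_trans (cover_le _ _)).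
  by apply: le_trans (g_high k0I) _; rewrite lerDl ler0n.
have [xI|xI] := boolP (x \in I).
  have := dP I I0 aI; rewrite mulnDr muln1 !natrD -(addn1 b) natrD; lra.
have := dP (x |: I); rewrite cardsU1 xI add1n big_setU1 //= => /(_ isT) dxI.
have {}dxI : ((cover P (x |: I))%:R <= #|I|.+1%:R * g #|I|.+1 + b%:R +
    (b.+1 * (served F x + \sum_(y in I) served F y))%:R)%R.
  by apply: dxI => y /setU1P[->|/aI].
have cA : ((cover P I)%:R + (load P x)%:R <= (cover P (x |: I))%:R + #|I|%:R :> R)%R.
  by rewrite -!natrD ler_nat cover_add.
have avg : ((cover P I)%:R - (b.+1 * \sum_(y in I) served F y)%:R <= #|I|%:R * danger P F x)%R.
  apply: le_trans (_ : \sum_(y in I) danger P F y <= _)%R.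
    rewrite /danger big_split /= sumrN -!natr_sum -big_distrr /= lerD2r ler_nat.
    exact: cover_sum.
  rewrite mulr_natl -sumr_const; apply: ler_sum => y yI; exact: mx (aI _ yI).
have gl := @g_low #|I|; rewrite I0 Ik0 in gl; have {}gl := gl isT.
rewrite addn0.
move: cI dxI cA avg gl; rewrite /danger !natrM (natrD _ (served F x) (\sum_(y in I) served F y)).
have -> : (#|I|.+1%:R = #|I|%:R + 1 :> R)%R by rewrite -(addn1 #|I|) natrD.
have K1 : (1 <= #|I|%:R :> R)%R by rewrite ler1n.
move: (#|I|%:R%R) (g #|I|.+1) (g #|I|) (b.+1%:R : R)%R K1 => k G' G c K1 cI dxI cA avg gl.
have {}gl : ((k + 1) * G' + b%:R + k + 3 <= (k + 1) * G)%R.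
  apply: le_trans (_ : (k + 1) * (G' + (b + 2)%:R / (k + 1) + 1) <= _)%R; last first.
    by rewrite ler_wpM2l // ; lra.
  have : ((b + 2)%:R / (k + 1) * (k + 1) = b%:R + 2 :> R)%R by rewrite divfK ?natrD // gt_eqF //; lra.
  by move: (_ / _)%R => q; lra.
(* [Y] is the cover of [I] less the credits, and [d] the danger of [x].  By
   [avg], [Y <= k * d]; multiplying the bound on [Y + d] by [k] then bounds
   [(k + 1) * Y]. *)
set Y := ((cover P I)%:R - c * (\sum_(y in I) served F y)%:R)%R in avg.
set d := ((load P x)%:R - c * (served F x)%:R)%R in avg.
suff : (Y + 1 <= k * G)%R by rewrite /Y; lra.
have dY : (Y + d <= (k + 1) * G' + b%:R + k)%R by rewrite /Y /d; lra.
have : (k * (Y + d) <= k * ((k + 1) * G' + b%:R + k))%R by rewrite ler_wpM2l //; lra.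
have : (k * ((k + 1) * G' + b%:R + k + 3) <= k * ((k + 1) * G))%R by rewrite ler_wpM2l //; lra.
move=> h1 h2; rewrite -(ler_pM2l (_ : 0 < k + 1)%R); last by lra.
nra.
Qed.

End Danger.

(** * Derandomized expansion *)

Section Potential.
Variables (R : realFieldType) (n m M : nat).
Hypothesis M_gt0 : 0 < M.
Implicit Types (F : {set box n * 'I_n}) (S N : {set 'I_n}) (x : box n).

Definition self_fed F (d : bool) S :=
  [forall v in S, forall u, ((v, d, u) \in F) ==> (u \in S)].

Definition deficit F d S := \sum_(v in S) (2 - served F (v, d)).

(** Suppose that the services still due to vertices of [S] were drawn at random
    among [M] candidates.  The weight bounds the probability that all services
    in direction [d] to [S] end up inside [S], given those recorded in [F]. *)
Definition weight F d S : R :=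
  if self_fed F d S then ((#|S|%:R / M%:R) ^+ deficit F d S)%R else 0%R.

Definition potential F : R :=
  (\sum_(d : bool) \sum_(S : {set 'I_n} | (0 < #|S| <= m)%N) weight F d S)%R.

Lemma self_fedP F d S :
  reflect (forall v u, v \in S -> (v, d, u) \in F -> u \in S) (self_fed F d S).
Proof.
apply: (iffP forall_inP) => [H v u vS|H v vS].
  by have /forallP/(_ u)/implyP := H v vS.
by apply/forallP => u; apply/implyP; apply: H.
Qed.

Lemma weight_ge0 F d S : (0 <= weight F d S)%R.
Proof. by rewrite /weight; case: ifP => // _; rewrite exprn_ge0 // divr_ge0 ?ler0n. Qed.

(** At most [#|S|] of the at least [M] candidates are in [S], and only these
    keep the weight of [S] from dropping to 0. *)
Lemma weight_step F x N d S : M <= #|N| -> served F x < 2 ->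
  (forall u, u \in N -> (x, u) \notin F) ->
  (\sum_(u in N) weight ((x, u) |: F) d S <= #|N|%:R * weight F d S)%R.
Proof.
move=> MN sx nF.
have [fS|nfS] := boolP (self_fed F d S); last first.
  rewrite big1 ?mulr_ge0 ?ler0n ?weight_ge0 // => u _; rewrite /weight ifF //.
  apply: contraNF nfS => /self_fedP H; apply/self_fedP => v w vS vw.
  by apply: (H v) => //; rewrite setU1r.
have [/andP[xS /eqP xd]|nxS] := boolP ((x.1 \in S) && (x.2 == d)); last first.
  rewrite mulr_natl -sumr_const; apply: ler_sum => u uN.
  rewrite /weight fS (_ : deficit _ d S = deficit F d S); last first.
    apply: eq_bigr => v vS; rewrite servedU ?nF // (_ : (v, d) == x = false) ?addn0 //.
    by apply: contraNF nxS => /eqP<-; rewrite /= vS eqxx.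
  by case: ifP => // _; rewrite exprn_ge0 // divr_ge0 ?ler0n.
have ex : x = (x.1, d) by rewrite -xd -surjective_pairing.
have def_d : deficit F d S = (deficit F d S).-1.+1.
  rewrite prednK // /deficit (bigD1 x.1) //= -ex; lia.
set q : R := (#|S|%:R / M%:R)%R.
have q0 : (0 <= q)%R by rewrite divr_ge0 ?ler0n.
apply: le_trans (_ : \sum_(u in N | u \in S) q ^+ (deficit F d S).-1 <= _)%R.
  rewrite big_mkcondr /=; apply: ler_sum => u uN.
  have [uS|uS] := boolP (u \in S); last first.
    rewrite /weight ifF //; apply: contraNF uS => /self_fedP H.
    by apply: (H x.1) => //; rewrite -ex setU11.
  rewrite /weight; case: ifP => _; last by rewrite exprn_ge0.
  rewrite (_ : deficit _ d S = (deficit F d S).-1) //.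
  rewrite /deficit (bigD1 x.1) //= [in RHS](bigD1 x.1) //= -ex servedU ?nF // eqxx.
  rewrite (eq_bigr (fun v => 2 - served F (v, d))); first by move: (\sum_(_ in _ | _) _); lia.
  move=> v /andP[_ vx]; rewrite servedU ?nF // ex xpair_eqE (negPf vx) addn0 //.
rewrite sumr_const -[leLHS]mulr_natl /weight fS -/q {2}def_d exprS mulrA.
apply: ler_wpM2r; first by rewrite exprn_ge0.
apply: le_trans (_ : #|S|%:R <= _)%R.
  by rewrite ler_nat; apply: subset_leq_card; apply/subsetP => u /andP[].
apply: le_trans (_ : M%:R * q <= _)%R; last by rewrite ler_wpM2r // ler_nat.
by rewrite /q mulrC divfK // pnatr_eq0 -lt0n.
Qed.

(** The method of conditional expectations: the average over [N] does not
    exceed the present value. *)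
Lemma potential_step F x N : M <= #|N| -> served F x < 2 ->
  (forall u, u \in N -> (x, u) \notin F) ->
  exists2 u, u \in N & (potential ((x, u) |: F) <= potential F)%R.
Proof.
move=> MN sx nF; apply/exists_inP/contraT.
rewrite negb_exists_in => /forall_inP H.
have : (\sum_(u in N) potential ((x, u) |: F) <= #|N|%:R * potential F)%R.
  rewrite exchange_big /= mulr_sumr; apply: ler_sum => d _.
  rewrite exchange_big /= mulr_sumr; apply: ler_sum => S _.
  exact: weight_step.
rewrite leNgt => /negP[]; rewrite mulr_natl -sumr_const.
apply: ltr_sum => [|u uN]; last by rewrite ltNge H.
have /card_gt0P[u uN] := leq_trans M_gt0 MN.
by apply/hasP; exists u => //; rewrite mem_index_enum.
Qed.

(** A set whose services are complete and all inside it has weight 1. *)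
Lemma potential_lt1 F d S : (potential F < 1)%R -> 0 < #|S| <= m -> self_fed F d S ->
  exists2 v, v \in S & served F (v, d) < 2.
Proof.
move=> pF Sm fS; apply/exists_inP/contraT; rewrite negb_exists_in => /forall_inP H.
have dS : deficit F d S = 0.
  by apply: big1 => v vS; have := H v vS; rewrite -leqNgt => ?; apply/eqP; rewrite subn_eq0.
move: pF; rewrite ltNge => /negP[]; rewrite /potential (bigD1 d) //= (bigD1 S) //=.
rewrite {1}/weight fS dS expr0 -addrA lerDl.
by rewrite addr_ge0 ?sumr_ge0 // => [T _|e _]; [|apply: sumr_ge0 => T _]; apply: weight_ge0.
Qed.

(** Both sides are compared with [(s + s)`!], using ['C(s + s, s) <= 4 ^ s]. *)
Lemma expnn_le_fact s : s ^ s <= 4 ^ s * s`!.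
Proof.
have h1 : 'C(s + s, s) <= 4 ^ s.
  rewrite (_ : 4 ^ s = 2 ^ (s + s)); last by rewrite expnD -expnMn.
  have := expnDn 1 1 (s + s); rewrite (_ : 1 + 1 = 2) // => ->.
  have ss : s < (s + s).+1 by rewrite ltnS leq_addr.
  by rewrite (bigD1 (Ordinal ss)) //= !exp1n !muln1 leq_addr.
have h2 : s ^ s * s`! <= (s + s)`!.
  suff H k : s ^ k * s`! <= (s + k)`! by exact: H.
  elim: k => [|k IH]; first by rewrite addn0 mul1n.
  rewrite addnS factS expnS -mulnA; apply: leq_mul => //; lia.
have := bin_fact (leq_addr s s); rewrite addnK => h3.
have f0 := fact_gt0 s.
have : s ^ s * s`! <= 4 ^ s * (s`! * s`!) by rewrite (leq_trans h2) // -h3 leq_mul2r h1 orbT.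
by rewrite mulnA leq_pmul2r.
Qed.

(** The sets of size [s] contribute at most [(4 n / s) ^ s * (s / M) ^ (2 s)],
    which is [(4 n s / M ^ 2) ^ s] and hence at most [4 ^- s]; the sum of these
    over [s] and the two directions is below [2 / 3]. *)
Lemma potential0_lt1 : 16 * n * m <= M ^ 2 -> (potential set0 < 1)%R.
Proof.
move=> hM.
have w0 d S : weight set0 d S = ((#|S|%:R / M%:R) ^+ (2 * #|S|))%R.
  rewrite /weight ifT; last by apply/self_fedP => v u _; rewrite inE.
  congr (_ ^+ _)%R; rewrite mulnC -sum_nat_const; apply: eq_bigr => v _.
  by rewrite /served (_ : [set u | _] = set0) ?cards0 //; apply/setP => u; rewrite !inE.
have term s : 0 < s <= m -> ('C(n, s)%:R * (s%:R / M%:R) ^+ (2 * s) <= (4%:R ^- s : R))%R.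
  move=> /andP[s0 sm].
  rewrite exprM expr_div_n exprMn exprVn -!natrX mulrA -natrM.
  rewrite ler_pdivrMr ?ltr0n ?expn_gt0 ?M_gt0 // mulrC.
  rewrite ler_pdivlMr ?ltr0n ?expn_gt0 // -natrM ler_nat.
  rewrite -(leq_pmul2r (fact_gt0 s)).
  have hb : 'C(n, s) * s`! <= n ^ s.
    rewrite bin_ffact; elim: (s) => // t IH; rewrite ffactnSr expnSr leq_mul //; exact: leq_subr.
  have : (16 * n * s) ^ s <= (M ^ 2) ^ s.
    by rewrite leq_exp2r // (leq_trans _ hM) // leq_mul2l sm orbT.
  move=> h; apply: leq_trans (leq_mul h (leqnn s`!)).
  apply: leq_trans (_ : n ^ s * s ^ s * (4 ^ s * s`!) * 4 ^ s <= _); last first.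
    by rewrite (_ : 16 = 4 * 4) // !expnMn; apply/eq_leq; ring.
  rewrite -[(s ^ 2) ^ s]expnM mul2n -addnn expnD.
  rewrite (_ : 'C(n, s) * _ * _ * _ = 'C(n, s) * s`! * s ^ s * s ^ s * 4 ^ s); last by ring.
  by rewrite leq_mul2r; apply/orP; right; apply: leq_mul (expnn_le_fact s); rewrite leq_mul2r hb orbT.
have -> : potential set0 = (2 * \sum_(S : {set 'I_n} | (0 < #|S| <= m)%N) (#|S|%:R / M%:R) ^+ (2 * #|S|))%R.
  rewrite /potential big_bool /= mulr_natl mulr2n; congr (_ + _)%R; apply: eq_bigr => S _; exact: w0.
rewrite (partition_big (fun S : {set 'I_n} => inord #|S| : 'I_m.+1) (fun s : 'I_m.+1 => (0 < s)%N)) /=; last first.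
  by move=> S /andP[S0 Sm]; rewrite inordK.
apply: le_lt_trans (_ : 2 * \sum_(s < m.+1 | (0 < s)%N) 4%:R ^- s < _)%R.
  rewrite ler_wpM2l ?ler0n //; apply: ler_sum => s s0.
  have -> : (\sum_(S : {set 'I_n} | (0 < #|S| <= m)%N && (inord #|S| == s)) (#|S|%:R / M%:R) ^+ (2 * #|S|)
     = 'C(n, s)%:R * (s%:R / M%:R) ^+ (2 * s) :> R)%R.
    have -> : 'C(n, s) = #|[set S : {set 'I_n} | #|S| == s]| by rewrite card_draws card_ord.
    rewrite mulr_natl -sumr_const; apply: eq_big.
      move=> S; rewrite inE; apply/andP/eqP => [[/andP[_ Sm] /eqP <-]|Ss].
        by rewrite inordK.
      by rewrite Ss s0 -ltnS ltn_ord inord_val eqxx.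
    by move=> S /andP[/andP[_ Sm] /eqP <-]; rewrite inordK.
  by apply: term; rewrite s0 -ltnS ltn_ord.
rewrite big_mkcond big_ord_recl /= add0r.
have -> : (\sum_(i < m) (if (0 < bump 0 i)%N then 4 ^- bump 0 i else 0) = (1 - 4%:R ^- m) / 3 :> R)%R.
  elim: (m) => [|t IH]; first by rewrite big_ord0 expr0 invr1 subrr mul0r.
  rewrite big_ord_recr /= IH /bump /= add1n exprS invfM; lra.
have : (0 < 4%:R ^- m :> R)%R by rewrite invr_gt0 exprn_gt0 // ltr0n.
lra.
Qed.

End Potential.

(** * Merging components *)

Definition arcs n (P : orientation n) : rel 'I_n := fun u v => (u, v) \in P.

Definition feeder n (P : orientation n) (d : bool) : rel 'I_n :=
  fun w u => feed (w, d) u \in P.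

(** The ancestors of [v] if [d] is [true], its descendants otherwise. *)
Definition reach_set n (P : orientation n) d v := [set w | connect (feeder P d) v w].

Definition all_reach n m (P : orientation n) := forall d v, m < #|reach_set P d v|.

Definition reach_pairs n (P : orientation n) := #|[set a | connect (arcs P) a.1 a.2]|.

Lemma reach_setT n (P : orientation n) v w :
  (w \in reach_set P true v) = connect (arcs P) w v.
Proof. by rewrite inE; apply: (connect_rev (arcs P) v w). Qed.

Lemma reach_setF n (P : orientation n) v w :
  (w \in reach_set P false v) = connect (arcs P) v w.
Proof. by rewrite inE. Qed.

Lemma feeder_sub n (P Q : orientation n) d v w : P \subset Q ->
  connect (feeder P d) v w -> connect (feeder Q d) v w.
Proof.
move=> /subsetP PQ; apply: connect_sub => x y xy; apply: connect1; exact: PQ.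
Qed.

Lemma reachU n (P Q : orientation n) v w :
  connect (arcs P) v w -> connect (arcs (P :|: Q)) v w.
Proof. by apply: (@feeder_sub n P (P :|: Q) false); apply: subsetUl. Qed.

Lemma all_reachU n m (P Q : orientation n) : all_reach m P -> all_reach m (P :|: Q).
Proof.
move=> bP d v; apply: leq_trans (bP d v) _; apply: subset_leq_card; apply/subsetP => w.
by rewrite !inE; apply: feeder_sub; apply: subsetUl.
Qed.

Lemma reach_pairsU n (P Q : orientation n) : reach_pairs P <= reach_pairs (P :|: Q).
Proof.
by apply: subset_leq_card; apply/subsetP => a; rewrite !inE; apply: reachU.
Qed.

Lemma reach_pairs_le n (P : orientation n) : reach_pairs P <= n ^ 2.
Proof. by apply: leq_trans (max_card _) _; rewrite card_prod card_ord mulnn. Qed.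

(** A reach set [S] is closed under feeding arcs.  If it had at most [m]
    elements, then a vertex of [S] would be fed by fewer than [m] vertices, so
    it would have been served twice, and all services to [S] would come from
    inside [S]; this is what the potential excludes. *)
Lemma expansion_reach (R : realFieldType) n m M (P : orientation n) F :
  proper_orientation P -> (potential R m M F < 1)%R ->
  (forall x u, (x, u) \in F -> feed x u \in P) ->
  (forall x, ~~ alive m P F x) -> all_reach m P.
Proof.
move=> pP pF FP nA d v; set S := reach_set P d v; rewrite ltnNge; apply/negP => Sm.
have S0 : 0 < #|S| by apply/card_gt0P; exists v; rewrite inE.
have cS w u : w \in S -> feed (w, d) u \in P -> u \in S.
  by rewrite !inE => vw wu; apply: connect_trans vw (connect1 _).
have fS : self_fed F d S by apply/self_fedP => w u wS /FP; apply: cS.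
have [|w wS sw] := potential_lt1 pF _ fS; first by rewrite S0.
have := nA (w, d); rewrite /alive sw /= -leqNgt leqNgt => /negP[]; apply: leq_trans Sm.
apply: proper_card; apply/properP; split; first by apply/subsetP => u; rewrite [in X in X -> _]inE; apply: cS.
exists w => //; rewrite inE; apply/negP; rewrite /feed /=.
by case: (d) => /pP[]; rewrite eqxx.
Qed.

(** A smallest reach set within that of [x] belongs to a sink component, or
    for [d = true] to a source component. *)
Lemma min_reach n (P : orientation n) d x : exists2 u, u \in reach_set P d x &
  forall w, w \in reach_set P d u -> u \in reach_set P d w.
Proof.
pose u := [arg min_(u < x in reach_set P d x) #|reach_set P d u|].
have [xu mu] : u \in reach_set P d x /\
    forall w, w \in reach_set P d x -> #|reach_set P d u| <= #|reach_set P d w|.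
  rewrite /u; case: arg_minnP => [|u' xu' mu']; first by rewrite inE connect0.
  by split=> // w; apply: mu'.
exists u => // w uw.
have sub : reach_set P d w \subset reach_set P d u.
  by apply/subsetP => z; move: uw; rewrite !inE; apply: connect_trans.
have xw : w \in reach_set P d x by move: xu uw; rewrite !inE; apply: connect_trans.
have /eqP -> : reach_set P d w == reach_set P d u by rewrite eqEcard sub mu.
by rewrite inE.
Qed.

(** [x] reaches a sink component [T], [y] is reached from a source component
    [S], and no vertex of [T] reaches one of [S].  If no edge between them were
    undirected, all of them would be arcs from [S] to [T], more than there are
    in [P].  An arc from [T] to [S] connects every vertex of [T] to every vertex
    of [S]. *)
Lemma merge_step n m (P : orientation n) : proper_orientation P -> all_reach m P ->
  #|P| < m ^ 2 -> (exists x y, ~~ connect (arcs P) x y) ->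
  exists t s, undirected P t s /\ reach_pairs P + m ^ 2 <= reach_pairs (P :|: [set (t, s)]).
Proof.
move=> pP bP cP [x [y nxy]].
have [u xu mu] := min_reach P false x; have [v yv mv] := min_reach P true y.
set T := reach_set P false u; set S := reach_set P true v.
have nTS t s : t \in T -> s \in S -> ~~ connect (arcs P) t s.
  move: xu yv; rewrite !reach_setT !reach_setF => xu vy ut sv; apply: contra nxy => ts.
  by apply: connect_trans xu (connect_trans ut (connect_trans ts (connect_trans sv vy))).
have cTS : m ^ 2 <= #|setX T S| by rewrite cardsX leq_mul // ltnW // bP.
have [t [s [tT sS stP]]] : exists t s, [/\ t \in T, s \in S & (s, t) \notin P].
  have : ~~ (setX S T \subset P).
    by apply: contraL cP => /subset_leq_card; rewrite -leqNgt; apply: leq_trans; rewrite cardsX mulnC -cardsX.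
  by case/subsetPn => -[s t]; rewrite inE => /andP[]; exists t, s.
exists t, s; split.
  rewrite /undirected stP andbT; apply/andP; split.
    by apply: contraNneq (nTS _ _ tT sS) => ->.
  by apply: contra (nTS _ _ tT sS) => ts; apply: connect1.
apply: leq_trans (_ : reach_pairs P + #|setX T S| <= _); first by rewrite leq_add2l.
rewrite /reach_pairs -cardsUI (_ : _ :&: _ = set0) ?cards0 ?addn0; last first.
  apply/setP => -[p q]; rewrite !inE /=; apply/negP => /and3P[pq pT qS].
  by have := nTS p q; rewrite !inE pT qS pq; move=> /(_ isT isT).
apply: subset_leq_card; apply/subsetP => -[p q]; rewrite in_setU in_setX !(inE, in_set) /=.
move=> /orP[|/andP[pT qS]]; first exact: reachU.
have pt : connect (arcs P) p t.
  have := mu p; rewrite inE => /(_ pT); rewrite reach_setF => pu; apply: connect_trans pu _.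
  by rewrite -reach_setF.
have sq : connect (arcs P) s q.
  have := mv q; rewrite inE => /(_ qS); rewrite reach_setT => vq.
  by apply: connect_trans vq; rewrite -reach_setT.
apply: connect_trans (reachU _ pt) (connect_trans (connect1 _) (reachU _ sq)).
by rewrite /arcs !inE eqxx orbT.
Qed.

Lemma strong_hamilton n (P : orientation n) : 1 < n -> proper_orientation P ->
  fully_oriented P -> (forall x y, connect (arcs P) x y) -> has_hamilton_cycle P.
Proof.
move=> n1 pP fP sP; have [||||c [cc uc al]] := @camion _ (arcs P).
- by move=> u v /pP[].
- move=> u v uv; rewrite /arcs; case: (boolP (_ \in P)) => //= nP; exact: (fully_oriented_arc fP uv nP).
- exact: sP.
- by rewrite card_ord.
by exists c; split=> //; apply/andP.
Qed.

(** * Maker's strategy *)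

Section Maker.
Variables (R : realFieldType) (n b m M k0 : nat) (g : nat -> R).
(* [mM] makes the potential start below 1, [g_high] and [g_low] are the
   conditions of [danger_maker], [g_one] turns the bound on the danger into [M]
   candidates for every service, and [few_merges] keeps the two phases so short
   that undirected edges remain between any two disjoint sets of size [m]. *)
Hypothesis n_gt1 : 1 < n.
Hypothesis M_gt0 : 0 < M.
Hypothesis mM : 16 * n * m <= M ^ 2.
Hypothesis g_ge0 : forall k, (0 <= g k)%R.
Hypothesis g_high : forall k, k0 <= k -> ((4 * n * b.+1)%:R <= k%:R * g k)%R.
Hypothesis g_low : forall k, 0 < k < k0 -> (g k.+1 + (b + 2)%:R / k.+1%:R + 1 <= g k)%R.
Hypothesis g_one : (g 1 + (b + b.+1 + m + M + 1)%:R <= n%:R)%R.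
Hypothesis few_merges : forall r, r * m ^ 2 <= n ^ 2 -> b.+1 * (4 * n + r) + b < m ^ 2.

Implicit Types (P Q : orientation n) (F : {set box n * 'I_n}) (x : box n) (u : 'I_n).

(** The first phase, with witness [F].  Every arc is charged to a round with
    one service, so that the bound on [#|F|] bounds the length of the phase. *)
Definition feeding a (P : orientation n) (F : {set box n * 'I_n}) : Prop :=
  [/\ danger_bounded b m g P F a,
      (potential R m M F < 1)%R,
      forall x u, (x, u) \in F -> feed x u \in P,
      #|P| <= b.+1 * #|F| + a
    & forall x, served F x <= 2].

(** The second phase after [r] rounds, each of which created [m ^ 2] connected
    pairs. *)
Definition merging a (P : orientation n) : Prop :=
  all_reach m P /\ exists2 r, r * m ^ 2 <= reach_pairs P & #|P| <= b.+1 * (4 * n + r) + a.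

Definition strong (P : orientation n) : Prop := forall u v, connect (arcs P) u v.

Definition maker_invariant a (P : orientation n) : Prop :=
  proper_orientation P /\ [\/ exists F, feeding a P F, merging a P | strong P].

Lemma maker_invariant0 : maker_invariant 0 set0.
Proof.
split; first exact: proper_set0.
constructor 1; exists set0; split.
- move=> I I0 _; rewrite (_ : cover _ _ = 0).
    by rewrite !addr_ge0 ?mulr_ge0 ?ler0n.
  by apply/eqP; rewrite -leqn0; apply: leq_trans (cover_le _ _) _; rewrite cards0.
- exact: potential0_lt1.
- by move=> x u; rewrite inE.
- by rewrite cards0.
- by move=> x; rewrite /served (_ : [set u | _] = set0) ?cards0 //; apply/setP => u; rewrite !inE.
Qed.

Lemma maker_invariant_widen P : maker_invariant 0 P -> maker_invariant b P.
Proof.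
move=> [pP iP]; split=> //; case: iP => [[F [dP pF FP cP sF]]|[rP [r rr cP]]|sP].
- constructor 1; exists F; split=> //; last by apply: leq_trans cP _; rewrite leq_add2l.
  by move=> I I0 aI; have := dP I I0 aI; have := ler0n R b; lra.
- constructor 2; split=> //; exists r => //; by apply: leq_trans cP _; rewrite leq_add2l.
- by constructor 3.
Qed.

Lemma maker_invariant_breaker P Q : maker_invariant 0 P -> orients_undirected P Q ->
  #|Q| <= b -> maker_invariant b (P :|: Q).
Proof.
move=> [pP iP] oQ Qb; split; first exact: proper_setU.
have cPQ : #|P :|: Q| <= #|P| + b.
  by apply: leq_trans (leq_card_setU _ _).1 _; rewrite leq_add2l.
case: iP => [[F [dP pF FP cP sF]]|[rP [r rr cP]]|sP].
- constructor 1; exists F; split=> //; last 2 first.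
  + by move=> x u /FP xu; rewrite inE xu.
  + by lia.
  exact: danger_breaker.
- constructor 2; split; first exact: all_reachU.
  by exists r; [apply: leq_trans rr (reach_pairsU _ _)|lia].
- by constructor 3 => x y; apply: reachU.
Qed.

(** The bound on the danger of the single box [x] leaves undirected edges at its
    vertex; an alive box has been served at most once, so its credit is at most
    [b.+1]. *)
Lemma feeding_candidates P F x : danger_bounded b m g P F b -> alive m P F x ->
  M <= #|[set u | undirected P x.1 u]|.
Proof.
move=> dP ax; have /andP[sx gx] := ax.
have := dP [set x]; rewrite cards1 cover1 big_set1 => /(_ isT) lx.
have {}lx : ((load P x)%:R <= 1 * g 1 + b%:R + (b.+1 * served F x)%:R)%R.
  by apply: lx => y /set1P->.
have s1 : ((b.+1 * served F x)%:R <= b.+1%:R :> R)%R.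
  by rewrite ler_nat -[leqRHS]muln1 leq_mul2l.
have : (load P x + (b + b.+1 + m + M + 1) <= n + b + b.+1)%N.
  by rewrite -(ler_nat R) !natrD; move: g_one lx s1; rewrite !natrD; lra.
have := degree_split P x; move: gx; lia.
Qed.

Lemma feed_undirected P (x : box n) u : undirected P x.1 u ->
  undirected P (feed x u).1 (feed x u).2.
Proof. by rewrite /feed; case: x => v [] //=; rewrite undirectedC. Qed.

Lemma feeding_step P F x0 : proper_orientation P -> feeding b P F -> alive m P F x0 ->
  exists x u, undirected P x.1 u /\
    feeding 0 (P :|: [set feed x u]) ((x, u) |: F).
Proof.
move=> pP fP ax0; have [dP pF FP cP sF] := fP.
have [x ax mx] : exists2 x, alive m P F x &
    forall y, alive m P F y -> (danger R b P F y <= danger R b P F x)%R.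
  by case: (arg_maxP (danger R b P F) ax0) => x ax mx; exists x.
have MN := feeding_candidates dP ax.
have nF u : u \in [set u | undirected P x.1 u] -> (x, u) \notin F.
  rewrite inE => /feed_undirected /and3P[_ nxu _].
  by apply: contra nxu => /FP; rewrite -surjective_pairing.
have [sx _] := andP ax.
have [u uN pu] := potential_step R m M_gt0 MN sx nF.
have nxu := nF u uN; move: uN; rewrite inE => xu.
have fF : #|(x, u) |: F| = #|F|.+1 by rewrite cardsU1 nxu.
have sF' y : served ((x, u) |: F) y <= 2.
  by rewrite servedU //; case: eqP => [->|_]; [lia|rewrite addn0].
have cP' : #|P :|: [set feed x u]| <= b.+1 * #|(x, u) |: F| + 0.
  apply: leq_trans (leq_card_setU _ _).1 _; rewrite cards1 fF; lia.
have F4 := card_served_le sF'.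
exists x, u; split=> //; split=> //.
- apply: (danger_maker g_high g_low dP ax nxu mx).
  by apply: leq_trans cP' _; rewrite addn0 mulnC leq_mul2r F4 orbT.
- exact: le_lt_trans pu pF.
- by move=> y w; rewrite !inE => /orP[/eqP[-> ->]|/FP ->]; rewrite ?eqxx ?orbT.
Qed.

Lemma maker_progress P : maker_invariant b P ->
  strong P \/ exists t s, undirected P t s /\ maker_invariant 0 (P :|: [set (t, s)]).
Proof.
move=> [pP iP]; have [sP|nsP] := pselect (strong P); [by left|right].
have mergingP : merging b P ->
    exists t s, undirected P t s /\ maker_invariant 0 (P :|: [set (t, s)]).
  move=> [rP [r rr cP]].
  have cP' : #|P| < m ^ 2.
    exact: leq_ltn_trans cP (few_merges (leq_trans rr (reach_pairs_le P))).
  have [|t [s [ts mts]]] := merge_step pP rP cP'.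
    by have /existsNP[x /existsNP[y /negP xy]] := nsP; exists x, y.
  exists t, s; split=> //; split; first exact: proper_setU (orients_set1 ts).
  constructor 2; split; first exact: all_reachU.
  exists r.+1; first by rewrite mulSn; lia.
  apply: leq_trans (leq_card_setU _ _).1 _; rewrite cards1; lia.
case: iP => [[F fP]|/mergingP //|sP]; last by case: nsP.
have [/existsP[x ax]|/existsPn nA] := boolP [exists x, alive m P F x].
  have [{ax}x [u [xu fP']]] := feeding_step pP fP ax.
  exists (feed x u).1, (feed x u).2; have fxu := feed_undirected xu; split=> //.
  rewrite -surjective_pairing; split; last by constructor 1; exists ((x, u) |: F).
  by apply: proper_setU; rewrite // [feed x u]surjective_pairing; apply: orients_set1.
apply: mergingP; have [_ pF FP cP sF] := fP; split; first exact: expansion_reach pP pF FP nA.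
exists 0 => //; apply: leq_trans cP _; rewrite addn0 leq_add2r leq_mul2l.
by rewrite (card_served_le sF) orbT.
Qed.

Lemma maker_wins : can_guarantee b Maker (fun T : orientation n => has_hamilton_cycle T).
Proof.
have full P : maker_invariant b P -> fully_oriented P -> has_hamilton_cycle P.
  move=> iP fP; have [pP _] := iP; case: (maker_progress iP) => [sP|[t [s [ts _]]]].
    exact: strong_hamilton.
  by case/not_fullyP: fP; exists t, s.
apply: (@strategy_of_invariants b n Maker (maker_invariant b) (maker_invariant 0)).
- exact: maker_invariant_widen maker_invariant0.
- move=> P iP nf; have [sP|[t [s [ts iP']]]] := maker_progress iP.
    have /not_fullyP[t [s ts]] := nf; exists [set (t, s)]; rewrite cards1.
    split=> //; first exact: orients_set1.
    split; first by have [pP _] := iP; apply: proper_setU (orients_set1 ts).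
    by constructor 3 => x y; apply: reachU.
  by exists [set (t, s)]; rewrite cards1; split=> //; apply: orients_set1.
- by move=> P Q iP oQ /andP[_ Qb]; apply: maker_invariant_breaker.
- exact: full.
- by move=> P /maker_invariant_widen; apply: full.
Qed.

End Maker.

(** * Asymptotics *)

Local Open Scope classical_set_scope.
Local Open Scope ring_scope.

Section Harmonic.
Variable R : realType.

Lemma ln_ge_harmonic k : (0 < k)%N ->
  \sum_(1 <= i < k) (i.+1%:R)^-1 <= ln k%:R :> R.
Proof.
elim: k => // -[|k] IH _; first by rewrite big_geq // ln1.
rewrite big_nat_recr //=; have {}IH := IH isT.
have : ln (k.+1%:R : R) <= ln k.+2%:R - k.+2%:R^-1.
  have k2 : 0 < k.+2%:R :> R by rewrite ltr0n.
  have -> : k.+1%:R = k.+2%:R * (1 - k.+2%:R^-1) :> R.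
    by rewrite mulrBr mulr1 mulfV ?gt_eqF // -[k.+2]addn1 natrD addrK.
  have k1 : k.+2%:R^-1 < 1 :> R by rewrite invf_lt1 // ltr1n.
  rewrite lnM ?posrE ?subr_gt0 // lerD2l.
  by apply: le_ln1Dx; rewrite ltrN2.
by rewrite lerBrDr; apply: le_trans; rewrite lerD2r.
Qed.

Lemma ln_le_harmonic k : (0 < k)%N ->
  ln k%:R <= \sum_(1 <= i < k) (i%:R)^-1 :> R.
Proof.
elim: k => // -[|k] IH _; first by rewrite big_geq // ln1.
rewrite big_nat_recr //=; have {}IH := IH isT.
have : ln (k.+2%:R : R) <= ln k.+1%:R + k.+1%:R^-1.
  have k1 : 0 < k.+1%:R :> R by rewrite ltr0n.
  have ki : 0 < k.+1%:R^-1 :> R by rewrite invr_gt0.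
  have -> : k.+2%:R = k.+1%:R * (1 + k.+1%:R^-1) :> R.
    by rewrite mulrDr mulr1 mulfV ?gt_eqF // -[k.+2]addn1 natrD.
  rewrite lnM ?posrE ?addr_gt0 // lerD2l.
  by apply: le_ln1Dx; rewrite (lt_trans _ ki) ?ltrN10.
by move=> /le_trans; apply; rewrite lerD2r.
Qed.

Lemma near_ln_ge (K : R) : \forall n \near \oo, K <= ln n%:R.
Proof.
apply: filterS (nbhs_infty_ger (expR K)) => n Kn.
by rewrite -(expRK K) ler_ln ?posrE ?expR_gt0 // (lt_le_trans (expR_gt0 K)).
Qed.

Lemma half_sqr_le_expR (x : R) : 0 <= x -> x ^+ 2 / 2 <= expR x.
Proof. by move=> x0; apply: le_trans (expR_ge1Dxn 1 x0); rewrite lerDr. Qed.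

End Harmonic.

(** [J n] is the largest index [j <= n] whose threshold [N j] is at most [n]. *)
Lemma diagonal (P : nat -> nat -> Prop) : (forall j, \forall n \near \oo, P j n) ->
  exists J : nat -> nat, (forall K, \forall n \near \oo, (K <= J n)%N) /\
    \forall n \near \oo, P (J n) n.
Proof.
move=> H.
have /choice[N HN] : forall j, exists N, forall n, (N <= n)%N -> P j n.
  by move=> j; have [N _ HN] := H j; exists N => n; apply: HN.
pose J n := (\max_(j < n.+1 | N j <= n) j)%N.
exists J; split.
  move=> K; exists (maxn K (N K)) => // n /=; rewrite geq_max => /andP[Kn NKn].
  exact: (@leq_bigmax_cond _ (fun j : 'I_n.+1 => N j <= n)%N val (Ordinal (Kn : (K < n.+1)%N)) NKn).
exists (N 0%N) => // n /= N0n.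
have [|j Nj ej] := @eq_bigmax_cond _ (fun j : 'I_n.+1 => N j <= n)%N val.
  by apply/card_gt0P; exists ord0.
by rewrite /J ej; apply: HN.
Qed.

Lemma cvg_inv_diagonal (R : realType) (J : nat -> nat) :
  (forall K, \forall n \near \oo, (K <= J n)%N) ->
  ((J n).+1%:R^-1 : R) @[n --> \oo] --> (0 : R).
Proof.
move=> HJ; apply/cvgrPdist_le => e e0.
have [K _ HK] := nbhs_infty_ger (e^-1).
apply: filterS (HJ K) => n Kn; rewrite sub0r normrN ger0_norm ?invr_ge0 //.
rewrite invf_ple ?posrE ?ltr0n //; apply: le_trans (HK (J n) Kn) _.
by rewrite ler_nat.
Qed.

(** With [k] about [n ^ (1 - d / 4)], the quotient [k / b] tends to 0, while
    [b ln k] is about [(1 - d / 4) b ln n], hence at least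
    [(1 + d) (1 - d / 4) n], which leaves room for the rounding errors. *)
Lemma breaker_asymptotic (R : realType) (d : R) : 0 < d <= 1 ->
  \forall n \near \oo, forall b : nat, n%:R * (1 + d) / ln n%:R <= b%:R ->
    can_guarantee b Breaker (fun T : orientation n =>
      (exists v : 'I_n, in_degree T v = 0%N) /\ ~ has_hamilton_cycle T).
Proof.
move=> /andP[d0 d1].
apply: filterS (near_ln_ge (128 / d ^+ 2)) => n Ln b.
set L := ln n%:R in Ln *.
have d2 : 0 < d ^+ 2 by rewrite exprn_gt0.
have Ld : 128 <= L * d ^+ 2 by rewrite -ler_pdivrMr.
have L0 : 0 < L by apply: lt_le_trans Ln; rewrite divr_gt0.
rewrite ler_pdivrMr // => bL.
have n0 : 0 < n%:R :> R by rewrite ltNge; apply/negP => /ln0 L0'; move: L0; rewrite /L L0' ltxx.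
have eL : expR L = n%:R by rewrite lnK.
set X := expR ((1 - d / 4) * L).
have X1 : 1 <= X by rewrite -expR0 ler_expR mulr_ge0 ?ltW //; lra.
set k := Num.truncn X.
have /andP[kX Xk] : k%:R <= X < k.+1%:R by apply: truncn_itv; lra.
have k0 : (0 < k)%N by rewrite truncn_ge_nat //; lra.
have k1 : 1 <= k%:R :> R by rewrite ler1n.
have X2k : X <= k%:R * 2 by move: Xk; rewrite -addn1 natrD; lra.
have lnk : (1 - d / 4) * L - 1 <= ln k%:R.
  have : ln X <= ln (k%:R * (1 + 1)) by rewrite ler_ln ?posrE ?mulr_gt0 ?expR_gt0 //; lra.
  rewrite expRK lnM ?posrE //; last by lra.
  have := @le_ln1Dx R 1; lra.
have eX : X * expR (d / 4 * L) = n%:R by rewrite -expRD -mulrDl subrK mul1r.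
(* [X = n / expR (d / 4 * L)], where the denominator is at least of order [L ^ 2]. *)
have Xb : X * 2 <= b%:R.
  have e2 : (d / 4 * L) ^+ 2 / 2 <= expR (d / 4 * L).
    by apply: half_sqr_le_expR; rewrite mulr_ge0 ?ltW ?divr_gt0.
  have h1 : X * ((d / 4 * L) ^+ 2 / 2) <= n%:R by rewrite -eX ler_wpM2l //; lra.
  have h2 : X * 4 * L <= X * ((d / 4 * L) ^+ 2 / 2).
    rewrite (_ : (d / 4 * L) ^+ 2 / 2 = L * (L * d ^+ 2 / 32)); last by field.
    rewrite -mulrA ler_wpM2l //; first lra.
    rewrite mulrC ler_wpM2l //; [lra|lra].
  rewrite -(ler_pM2r L0); apply: le_trans (_ : n%:R <= _); first by nra.
  by apply: le_trans bL; nra.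
have kb2 : (2 * k <= b)%N by rewrite -(ler_nat R) natrM; lra.
apply: (@breaker_wins n b k) => //.
  rewrite -(ler_nat R); apply: le_trans kX _; rewrite -eL ler_expR; nra.
rewrite -(ler_nat R) natr_sum.
apply: le_trans (_ : \sum_(1 <= i < k) (b%:R * i%:R^-1 - 1) <= _); last first.
  apply: ler_sum_nat => i /andP[i1 _].
  rewrite lerBlDr ler_pdivrMr ?ltr0n // -(natrD _ _ 1) -natrM ler_nat addn1.
  by rewrite ltnW // ltn_ceil.
rewrite big_split /= -mulr_sumr sumr_const_nat.
have := ln_le_harmonic R k0; set H := \sum_(_ <= _ < _) _ => lH.
have {lH lnk}lH : (1 - d / 4) * L - 1 <= H by lra.
have k1b : (k - 1)%N%:R <= b%:R / 2 :> R.
  apply: le_trans (_ : k%:R <= _); first by rewrite ler_nat leq_subr.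
  lra.
have b0 : 0 <= b%:R :> R by [].
have bH : b%:R * ((1 - d / 4) * L - 1) <= b%:R * H by rewrite ler_wpM2l.
have bd : b%:R * 128 <= b%:R * L * d by nra.
have : n%:R <= b%:R * ((1 - d / 4) * L - 1) - b%:R / 2.
  have : n%:R * (1 + d) * (1 - d / 2) <= b%:R * L * (1 - d / 2) by rewrite ler_wpM2r //; lra.
  have : 0 <= n%:R * (d * (1 - d)) by rewrite !mulr_ge0 //; lra.
  nra.
rewrite mulNrn; lra.
Qed.

(** [M] and [k0] are [d n / 8], and [m] is [d ^ 2 n / 2000], small enough for
    [16 n m <= M ^ 2].  The function [g] solves the recursion of
    [danger_maker] with equality, starting from the value at [k0] forced by the
    total number of arcs, so that [g 1] is at most
    [b ln n + d n / 8 + o(n)]. *)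
Lemma maker_asymptotic (R : realType) (d : R) : 0 < d <= 1 ->
  \forall n \near \oo, forall b : nat, b%:R <= n%:R * (1 - d) / ln n%:R ->
    can_guarantee b Maker (fun T : orientation n => has_hamilton_cycle T).
Proof.
move=> /andP[d0 d1].
have [C defC] : exists C : R, C = 10 * 100 * 100 * 100 * 100 by eexists.
have C0 : 0 < C by lra.
apply: filterS (near_ln_ge (C / d ^+ 4)) => n Ln b.
set L := ln n%:R in Ln *.
have d4 : 0 < d ^+ 4 by rewrite exprn_gt0.
have L0 : 0 < L by apply: lt_le_trans Ln; rewrite divr_gt0.
have {Ln}Ld : C <= L * d ^+ 4 by rewrite -ler_pdivrMr.
rewrite ler_pdivlMr // => bL.
set N : R := n%:R in bL *.
have N0 : 0 < N by rewrite ltNge; apply/negP => /ln0 L0'; move: L0; rewrite /L L0' ltxx.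
have eL : expR L = N by rewrite lnK.
have b0 : 0 <= b%:R :> R by [].
(* [u], which is [o(n)], bounds [b], [L / 2] and 1 at once. *)
have [u uC] : exists u, u * C = d ^+ 4 * N by exists (d ^+ 4 * N / C); rewrite divfK // gt_eqF.
have LN : L <= N by rewrite -eL; apply: le_trans (expR_ge1Dx L); rewrite lerDr.
have bu : b%:R <= u.
  rewrite -(ler_pM2r C0) uC; apply: le_trans (_ : b%:R * (L * d ^+ 4) <= _); first by rewrite ler_wpM2l.
  rewrite mulrA mulrC ler_wpM2l ?(ltW d4) //; apply: le_trans bL _.
  by rewrite ger_pMr // lerBlDl lerDr ltW.
have u1 : 1 <= u.
  rewrite -(ler_pM2r C0) uC mul1r; apply: le_trans Ld _.
  by rewrite mulrC ler_wpM2l // ltW.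
have Lu : L <= 2 * u.
  have h : L ^+ 2 / 2 <= N by rewrite -eL; apply/half_sqr_le_expR/ltW.
  rewrite -(ler_pM2r C0) -mulrA uC; apply: le_trans (_ : L * (L * d ^+ 4) <= _).
    by rewrite ler_wpM2l // ltW.
  rewrite mulrA -expr2 [leRHS]mulrCA mulrC ler_wpM2l ?(ltW d4) //; lra.
have w0 : 0 < d * N by rewrite mulr_gt0.
have w2 : 0 < d ^+ 2 * N by rewrite mulr_gt0 ?exprn_gt0.
have d2Nd : d ^+ 2 * N <= d * N by rewrite ler_pM2r // expr2 ger_pMr.
have d3_le : d ^+ 3 * N <= d * N by rewrite ler_pM2r // exprS ger_pMr // exprn_ile1 // ltW.
have vC : u / d * C = d ^+ 3 * N by rewrite mulrAC uC exprS; field; rewrite gt_eqF.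
have v_small : u / d <= d * N / 10 / 100.
  rewrite -(ler_pM2r C0) vC; apply: le_trans d3_le _.
  by move: (d * N) w0 => w w0; rewrite defC; lra.
have u_small : u <= u / d by rewrite ler_pdivlMr // ger_pMr //; lra.
have u_d2 : u <= d ^+ 2 * N / 100 / 100 / 100.
  rewrite -(ler_pM2r C0) uC; apply: le_trans (_ : d ^+ 2 * N <= _).
    by rewrite ler_pM2r // -[4%N]/(2 + 2)%N exprD ger_pMr ?exprn_gt0 // exprn_ile1 // ltW.
  by move: (d ^+ 2 * N) w2 => w' w'0; rewrite defC; lra.
have C_large : 20 * 40 * 100 * 40 * 100 <= C by lra.
clear defC vC d3_le.
set M := Num.truncn (d * N / 8); set m := Num.truncn (d ^+ 2 * N / 20 / 100).
have /andP[M_le M_gt] : M%:R <= d * N / 8 < M.+1%:R by apply: truncn_itv; lra.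
have /andP[m_le m_gt] : m%:R <= d ^+ 2 * N / 20 / 100 < m.+1%:R.
  by apply: truncn_itv; lra.
move: M_gt m_gt; rewrite -(addn1 M) -(addn1 m) !natrD => M_gt m_gt.
have {}M_gt : d * N / 10 <= M%:R by lra.
have {}m_gt : d ^+ 2 * N / 40 / 100 <= m%:R by lra.
have M0 : 0 < M%:R :> R by lra.
pose g k : R := 4 * N * (b + 1)%:R / M%:R + \sum_(k <= i < M) ((b + 2)%:R / i.+1%:R + 1).
apply: (@maker_wins R n b m M M g).
- rewrite -(ltr_nat R) -/N; nra.
- by rewrite -(ltr_nat R).
- rewrite -(ler_nat R) !natrM -/N -expr2.
  apply: le_trans (_ : (d * N / 10) ^+ 2 <= _); last by rewrite lerXn2r ?nnegrE //; lra.
  apply: le_trans (_ : 16 * N * (d ^+ 2 * N / 20 / 100) <= _); first by rewrite ler_wpM2l ?mulr_ge0 //; lra.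
  by have := sqr_ge0 (d * N); lra.
- move=> k; apply: addr_ge0; first by rewrite divr_ge0 // mulr_ge0 // mulr_ge0 // ltW.
  by apply: sumr_ge0 => i _; rewrite addr_ge0 // divr_ge0.
- move=> k Mk; rewrite /g big_geq // addr0 !natrM addn1 -/N.
  rewrite mulrA ler_pdivlMr // mulrC ler_wpM2r ?mulr_ge0 ?ler_nat //; lra.
- by move=> k /andP[k0 kM]; rewrite /g (big_ltn kM) le_eqVlt -!addrA (addrC (\sum_(_ <= _ < _) _)) !addrA eqxx.
- rewrite /g big_split /= sumr_const_nat -mulr_sumr.
  have M1 : (0 < M)%N by rewrite -(ltr_nat R).
  have MN : M%:R <= N by apply: le_trans M_le _; rewrite ler_pdivrMr // mulrC ler_wpM2l ?(ltW N0) //; lra.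
  set H := \sum_(_ <= _ < _) _.
  have HL : H <= L.
    by apply: le_trans (ln_ge_harmonic R M1) _; rewrite /L ler_ln ?posrE.
  (* The value of [g] at [k0] is of order [b / d], which is [o(n)]. *)
  have h0 : 4 * N * (b + 1)%:R / M%:R <= 80 * (u / d).
    rewrite ler_pdivrMr //.
    apply: le_trans (_ : 80 * (u / d) * (d * N / 10) <= _); last first.
      by rewrite ler_wpM2l // mulr_ge0 // divr_ge0 // ltW // (lt_le_trans _ u1).
    rewrite (_ : 80 * _ * _ = 4 * N * (u + u)); last by field; rewrite gt_eqF.
    by rewrite ler_wpM2l ?mulr_ge0 ?(ltW N0) // natrD lerD.
  have h1 : (b + 2)%:R * H <= N * (1 - d) + 4 * u.
    apply: le_trans (_ : (b + 2)%:R * L <= _); first by rewrite ler_wpM2l.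
    by rewrite natrD mulrDl lerD //; lra.
  have h2 : (M - 1)%N%:R <= M%:R :> R by rewrite ler_nat leq_subr.
  move: (4 * N * _ / _) h0 => G0 h0.
  move: ((b + 2)%:R * H) ((M - 1)%N%:R) h1 h2 => G1 G2 h1 h2.
  rewrite -(addn1 b) !natrD -/N.
  move: (u / d) v_small u_small h0 => v v_small u_small h0.
  clear -M_le m_le d2Nd h0 h1 h2 bu u1 v_small u_small w0.
  lra.
- move=> r; rewrite -(ler_nat R) -(ltr_nat R) => rm.
  (* As [m ^ 2] has order [n ^ 2], it exceeds the [O(b n)] arcs of both phases. *)
  have m2 : 20 * u * N <= m%:R ^+ 2.
    apply: le_trans (_ : (d ^+ 2 * N / 40 / 100) ^+ 2 <= _); last first.
      by rewrite lerXn2r ?nnegrE //; lra.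
    have -> : (d ^+ 2 * N / 40 / 100) ^+ 2 = u * N * (C / (40 * 100 * 40 * 100)).
      by transitivity (u * C * N / (40 * 100 * 40 * 100)); [rewrite uC; field|field].
    rewrite -!mulrA mulrCA ler_wpM2l //; first by lra.
    rewrite mulrC ler_wpM2l ?(ltW N0) //; lra.
  have N1 : 1 <= N by rewrite ler1n -(ltr_nat R).
  have rN : r%:R <= N.
    have : r%:R * (20 * u * N) <= N ^+ 2.
      apply: le_trans (_ : r%:R * m%:R ^+ 2 <= _); first by rewrite ler_wpM2l.
      by move: rm; rewrite natrM !natrX.
    rewrite expr2 mulrA ler_pM2r //; apply: le_trans.
    by rewrite ler_peMr //; lra.
  rewrite natrD natrM natrX; apply: lt_le_trans m2.
  apply: le_lt_trans (_ : (2 * u) * (5 * N) + u * N < _).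
    apply: lerD; last by apply: le_trans bu _; rewrite ler_peMr //; lra.
    apply: ler_pM => //; first by rewrite -(addn1 b) natrD; lra.
    by rewrite natrD natrM -/N; lra.
  have uN0 : 0 < u * N by rewrite mulr_gt0 //; lra.
  lra.
Qed.

Theorem theorem2 (R : realType) :
  exists eps1 eps2 : nat -> R,
    eps1 n @[n --> \oo] --> (0 : R) /\
    eps2 n @[n --> \oo] --> (0 : R) /\
    \forall n \near \oo, forall b : nat, (0 < b)%N ->
      (n%:R * (1 + eps1 n) / ln n%:R <= b%:R ->
        can_guarantee b Breaker (fun T : orientation n =>
          (exists v : 'I_n, in_degree T v = 0%N) /\ ~ has_hamilton_cycle T))
      /\
      (b%:R <= n%:R * (1 + eps2 n) / ln n%:R ->
        can_guarantee b Maker (fun T : orientation n => has_hamilton_cycle T)).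
Proof.
pose P j n := forall b : nat,
  (n%:R * (1 + j.+1%:R^-1) / ln n%:R <= b%:R :> R ->
    can_guarantee b Breaker (fun T : orientation n =>
      (exists v : 'I_n, in_degree T v = 0%N) /\ ~ has_hamilton_cycle T)) /\
  (b%:R <= n%:R * (1 - j.+1%:R^-1) / ln n%:R :> R ->
    can_guarantee b Maker (fun T : orientation n => has_hamilton_cycle T)).
have nearP j : \forall n \near \oo, P j n.
  have d01 : 0 < (j.+1%:R^-1 : R) <= 1.
    by rewrite invr_gt0 ltr0n invf_le1 ?ltr0n // ler1n.
  apply: filterS2 (breaker_asymptotic d01) (maker_asymptotic d01) => n HB HM b.
  by split; [apply: HB|apply: HM].
have [J [J_oo nearJ]] := diagonal nearP.
exists (fun n => (J n).+1%:R^-1), (fun n => - (J n).+1%:R^-1); split.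
  exact: cvg_inv_diagonal.
split; first by rewrite -oppr0; apply: cvgN; apply: cvg_inv_diagonal.
by apply: filterS nearJ => n Pn b _; apply: Pn.
Qed.
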